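(* Let $\mathbb{K}$ be a field, let $S=\mathbb{K}[x_1,\ldots,x_n]$, and let $I\subset S$ be a nonzero proper homogeneous ideal. Then $\rho_a(I)=\overline{\rho}_a(I)=\overline{\rho}(I)$. In particular, if $I$ is normal (that is, if all powers $I^r$, $r\ge 1$, are integrally closed), then $\rho_a(I)=\rho(I)$.
   Context: Symbolic powers: $I^{(s)}=\bigcap_{P\in\mathrm{Ass}(I)}(I^sS_P\cap S)$. The integral closure of an ideal $J$ is denoted $\overline{J}$. With $s,r$ ranging over positive integers, define $$\rho(I)=\sup\left\{\tfrac{s}{r}: I^{(s)}\not\subset I^r\right\},\qquad \rho_a(I)=\sup\left\{\tfrac{s}{r}: I^{(st)}\not\subset I^{rt}\text{ for all } t\gg 0\right\},$$ $$\overline{\rho}(I)=\sup\left\{\tfrac{s}{r}: I^{(s)}\not\subset \overline{I^r}\right\},\qquad \overline{\rho}_a(I)=\sup\left\{\tfrac{s}{r}: I^{(st)}\not\subset \overline{I^{rt}}\text{ for all } t\gg 0\right\}.$$ *)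

(* Defs.v *)
From HB Require Import structures.
From mathcomp Require Import all_boot all_order all_algebra.
From mathcomp Require Import mpoly.
From mathcomp Require Import boolp classical_sets filter reals ereal.

Set Implicit Arguments.
Unset Strict Implicit.
Unset Printing Implicit Defensive.

Import Order.TTheory GRing.Theory Num.Theory.

Local Open Scope classical_set_scope.
Local Open Scope ring_scope.

Section LinearCombinations.
Variable R : comNzRingType.
Implicit Types A B I J : set R.

(* Finite sums of products b * a with b in B and a in A: for a subring B, this
   is the B-submodule of R generated by A. *)
Definition lincomb B A : set R :=
  [set x | exists (k : nat) (b a : 'I_k -> R),
    [/\ forall i, B (b i), forall i, A (a i) & x = \sum_(i < k) b i * a i]].

Definition ideal_gen A : set R := lincomb setT A.

Definition ideal_mul I J : set R := ideal_gen [set x * y | x in I & y in J].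

(* I ^ 0 is the unit ideal. *)
Definition ideal_exp I (r : nat) : set R := iter r (ideal_mul I) setT.

(* f is integral over J when
   f ^ m + c_1 f ^ (m - 1) + ... + c_m = 0 with m >= 1 and c_i in J ^ i. *)
Definition integral_closure J : set R :=
  [set f | exists (m : nat) (c : nat -> R),
    [/\ (0 < m)%N,
        forall i, (1 <= i <= m)%N -> ideal_exp J i (c i)
      & f ^+ m + \sum_(1 <= i < m.+1) c i * f ^+ (m - i) = 0]].

Definition normal_ideal I : Prop :=
  forall r : nat, (0 < r)%N ->
    integral_closure (ideal_exp I r) = ideal_exp I r.

(* The primes of the form (I : f); [idealr_closed] includes properness. *)
Definition associated_primes I : set (set R) :=
  [set P | [/\ idealr_closed (mem P), prime_idealr_closed (mem P)
             & exists f : R, P = [set g | I (g * f)]]].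

End LinearCombinations.

Section SymbolicPowers.
Variable R : idomainType.
Implicit Types I J P : set R.

(* The localization of R at P, as a subring of the fraction field of R. *)
Definition localization P : set {fraction R} :=
  [set tofrac a / tofrac b | a in setT & b in ~` P].

(* The ideal of the localization at P generated by J. *)
Definition ideal_extension P J : set {fraction R} :=
  lincomb (localization P) (@tofrac R @` J).

Definition symbolic_power I (s : nat) : set R :=
  \bigcap_(P in associated_primes I)
    (@tofrac R @^-1` ideal_extension P (ideal_exp I s)).

End SymbolicPowers.

Definition homogeneous_ideal (K : fieldType) (n : nat)
    (I : set {mpoly K[n]}) : Prop :=
  exists2 G : set {mpoly K[n]},
    (forall g, G g -> g \is ishomog mdeg) & I = ideal_gen G.

Section Resurgence.
Variables (F : realType) (R : idomainType).
Implicit Type I : set R.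

(* The supremum is taken in the extended reals. *)
Definition sup_ratio (Q : nat -> nat -> Prop) : \bar F :=
  ereal_sup [set q | exists s r : nat,
    [/\ (0 < s)%N, (0 < r)%N, Q s r & q = (s%:R / r%:R)%:E]].

Definition resurgence I : \bar F :=
  sup_ratio (fun s r => ~ (symbolic_power I s `<=` ideal_exp I r)).

Definition asymptotic_resurgence I : \bar F :=
  sup_ratio (fun s r => \forall t \near \oo,
    ~ (symbolic_power I (s * t) `<=` ideal_exp I (r * t))).

Definition ic_resurgence I : \bar F :=
  sup_ratio (fun s r =>
    ~ (symbolic_power I s `<=` integral_closure (ideal_exp I r))).

Definition ic_asymptotic_resurgence I : \bar F :=
  sup_ratio (fun s r => \forall t \near \oo,
    ~ (symbolic_power I (s * t) `<=` integral_closure (ideal_exp I (r * t)))).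

End Resurgence.

(* Main.v *)
Require Import Defs.
From HB Require Import structures.
From mathcomp Require Import all_boot all_order all_algebra closed_field.
From mathcomp Require Import mpoly zify.
From mathcomp Require Import boolp classical_sets filter reals ereal.

Set Implicit Arguments.
Unset Strict Implicit.
Unset Printing Implicit Defensive.

Import Order.TTheory GRing.Theory Num.Theory.

Local Open Scope classical_set_scope.
Local Open Scope ring_scope.

(** The inequalities among the three quantities are formal except for one.
    Dropping the integral closure enlarges the set of admissible ratios, so the
    asymptotic resurgence is at least its integral closure version. If [f] lies
    in the symbolic power of order [s] but is not integral over [I ^ r], then
    [f ^+ t] lies in the symbolic power of order [s * t] ([symbolic_powerX]) and
    is not integral over [I ^ (r * t)] ([integral_closure_root]); so the
    non-asymptotic supremum is at most the asymptotic one.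

    The remaining inequality needs a constant [l], depending on [I] only, such
    that the integral closure of [I ^ (r + l)] is contained in [I ^ r] for all
    [r]: a Briancon-Skoda inclusion ([briancon_skoda]), where [l] can be the
    number of generators of [I]. A ratio [s / r] above the supremum for integral
    closures stays above it after replacing [s / r] by [s * t / (r * t + l)]
    with [t] large, so the symbolic power of order [s * t] is contained in the
    integral closure of [I ^ (r * t + l)], hence in [I ^ (r * t)].

    Over an algebraically closed field of characteristic [p], the inclusion is
    proved as in the theory of tight closure. If [z] is integral over
    [I ^ (r + l)], there is [c != 0] with [c * z ^+ q] in [I ^ ((r + l) * q)]
    for all [q] ([integral_multiplier]); for [q] a power of [p], the latter ideal
    is contained, by the pigeonhole principle, in the ideal generated by the
    [q]-th powers of the elements of [I ^ r] ([ideal_exp_frobenius]). Since the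
    polynomial ring is free over its subring of [q]-th powers, this forces [z]
    into [I ^ r] ([frobenius_multiplier]).

    An arbitrary field is reduced to this case by specialization. Finitely many
    scalars satisfying polynomial equations over the integers can be replaced by
    elements of an algebraically closed field of positive characteristic that
    satisfy the same equations ([specializable_cover]). Being integral over a
    power of [I] is given by such equations, but not belonging to [I ^ r] is not
    obviously so. Here homogeneity of [I] helps: membership of [z] in [I ^ r] is
    a finite linear system in bounded degree, and the failure of a linear system
    is witnessed by a solution of the dual one ([separating_coefficients]), which
    is again given by equations. *)

(** * Ideals, their powers and integral closures *)

Section Ideals.
Variable R : comNzRingType.
Implicit Types A B I J : set R.

Definition ideal_set I : Prop :=
  [/\ I 0, forall x y, I x -> I y -> I (x + y) & forall a x, I x -> I (a * x)].

Lemma ideal_sum I (T : Type) (s : seq T) (P : pred T) (F : T -> R) :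
  ideal_set I -> (forall i, P i -> I (F i)) -> I (\sum_(i <- s | P i) F i).
Proof. by case=> I0 ID _ IF; elim/big_ind: _. Qed.

Lemma ideal_opp I x : ideal_set I -> I x -> I (- x).
Proof. by case=> _ _ IM Ix; rewrite -mulN1r; apply: IM. Qed.

Lemma ideal_mull I a x : ideal_set I -> I x -> I (a * x).
Proof. by case=> _ _; apply. Qed.

Lemma ideal_mulr I a x : ideal_set I -> I x -> I (x * a).
Proof. by rewrite mulrC; apply: ideal_mull. Qed.

Lemma lincomb0 A B : lincomb B A 0.
Proof.
by exists 0%N, (fun=> 0), (fun=> 0); split=> [[]//|[]//|]; rewrite big_ord0.
Qed.

Lemma lincombD A B x y : lincomb B A x -> lincomb B A y -> lincomb B A (x + y).
Proof.
move=> [k [b [a [Bb Aa ->]]]] [k' [b' [a' [Bb' Aa' ->]]]].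
pose glue (u : 'I_k -> R) (v : 'I_k' -> R) i :=
  match split i with inl j => u j | inr j => v j end.
exists (k + k')%N, (glue b b'), (glue a a'); split=> [i|i|].
- by rewrite /glue; case: split.
- by rewrite /glue; case: split.
rewrite big_split_ord /=; congr (_ + _); apply: eq_bigr => i _; rewrite /glue.
  by rewrite -[lshift _ _]/(unsplit (inl i)) unsplitK.
by rewrite -[rshift _ _]/(unsplit (inr i)) unsplitK.
Qed.

Lemma lincomb1 A B b a : B b -> A a -> lincomb B A (b * a).
Proof.
by move=> Bb Aa; exists 1%N, (fun=> b), (fun=> a); split=> //; rewrite big_ord1.
Qed.

Lemma lincomb_ind A B (P : R -> Prop) :
  P 0 -> (forall x y, P x -> P y -> P (x + y)) ->
  (forall b a, B b -> A a -> P (b * a)) -> forall x, lincomb B A x -> P x.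
Proof.
move=> P0 PD PM x [k [b [a [Bb Aa ->]]]].
by elim/big_ind: _ => // i _; apply: PM.
Qed.

Lemma lincombM B A A' A'' x y : (forall b b', B b -> B b' -> B (b * b')) ->
  (forall a a', A a -> A' a' -> A'' (a * a')) ->
  lincomb B A x -> lincomb B A' y -> lincomb B A'' (x * y).
Proof.
move=> BM AM Ax A'y; elim/lincomb_ind: Ax => {x} [|x x' IHx IHx'|b a Bb Aa].
- by rewrite mul0r; apply: lincomb0.
- by rewrite mulrDl; apply: lincombD.
elim/lincomb_ind: A'y => {y} [|y y' IHy IHy'|b' a' Bb' Aa'].
- by rewrite mulr0; apply: lincomb0.
- by rewrite mulrDr; apply: lincombD.
by rewrite mulrACA; apply: lincomb1; [apply: BM | apply: AM].
Qed.

Lemma ideal_gen_ideal A : ideal_set (ideal_gen A).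
Proof.
split; [exact: lincomb0 | exact: lincombD |] => c x.
elim/lincomb_ind=> {x} [|x y IHx IHy|b a _ Aa].
- by rewrite mulr0; apply: lincomb0.
- by rewrite mulrDr; apply: lincombD.
by rewrite mulrA; apply: lincomb1.
Qed.

Lemma sub_ideal_gen A : A `<=` ideal_gen A.
Proof. by move=> x Ax; rewrite -[x]mul1r; apply: lincomb1. Qed.

Lemma ideal_gen_min A I : ideal_set I -> A `<=` I -> ideal_gen A `<=` I.
Proof.
move=> II AI x; have [I0 ID IM] := II.
by elim/lincomb_ind=> // b a _ /AI; apply: IM.
Qed.

(** For finitely many generators the coefficients can be indexed by the
    generators themselves, which is what makes membership a linear system. *)
Lemma ideal_gen_range (T : finType) (g : T -> R) x :
  ideal_gen (range g) x -> exists h : T -> R, x = \sum_t h t * g t.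
Proof.
elim/lincomb_ind=> {x} [|x y [h ->] [h' ->]|b _ _ [t _ <-]].
- by exists (fun=> 0); rewrite big1 // => t _; rewrite mul0r.
- by exists (h \+ h'); rewrite -big_split; apply: eq_bigr => t _; rewrite mulrDl.
exists (fun u => b * (u == t)%:R); rewrite (bigD1 t) //= eqxx mulr1 big1 ?addr0 //.
by move=> u /negPf ->; rewrite mulr0 mul0r.
Qed.

Lemma ideal_exp_ideal I r : ideal_set (ideal_exp I r).
Proof. by case: r => [|r]; [split | apply: ideal_gen_ideal]. Qed.

Lemma ideal_expS I r x y : I x -> ideal_exp I r y -> ideal_exp I r.+1 (x * y).
Proof. by move=> Ix Iy; apply: sub_ideal_gen; exists x => //; exists y. Qed.

(** The powers of [I] are the least family of ideals that starts at the unit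
    ideal and absorbs [I]. Choosing the family [Q] gives every property of the
    elements of a power, so that no expansion into sums of products is needed. *)
Lemma ideal_exp_min I (Q : nat -> set R) :
  (forall x, Q 0%N x) -> (forall r, ideal_set (Q r)) ->
  (forall r x y, I x -> Q r y -> Q r.+1 (x * y)) ->
  forall r, ideal_exp I r `<=` Q r.
Proof.
move=> Q0 QI QS; elim=> [|r IHr] x; first by move=> _.
apply: ideal_gen_min => // _ [u Iu [v Iv <-]].
by apply: QS => //; apply: IHr.
Qed.

Lemma ideal_expM I a b x y :
  ideal_exp I a x -> ideal_exp I b y -> ideal_exp I (a + b) (x * y).
Proof.
move=> Iax Iby; suff: ideal_exp I a `<=` [set x | ideal_exp I (a + b) (x * y)].
  exact.
apply: (@ideal_exp_min _ (fun a => [set x | ideal_exp I (a + b) (x * y)])).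
- by move=> z; rewrite add0n /=; apply: ideal_mull => //; apply: ideal_exp_ideal.
- move=> r; have [I0 ID IM] := ideal_exp_ideal I (r + b); split=> [|u v Iu Iv|u v Iv] /=.
  + by rewrite mul0r.
  + by rewrite mulrDl; apply: ID.
  + by rewrite -mulrA; apply: IM.
- by move=> r u v Iu Iv; rewrite /= -mulrA; apply: ideal_expS.
Qed.

Lemma ideal_exp_pow I x k : I x -> ideal_exp I k (x ^+ k).
Proof. by move=> Ix; elim: k => // k IHk; rewrite exprS; apply: ideal_expS. Qed.

Lemma ideal_exp_le I a b : (a <= b)%N -> ideal_exp I b `<=` ideal_exp I a.
Proof.
move=> ab; rewrite -(subnK ab); elim: (b - a)%N => [|k IHk] x //.
rewrite addSn => Ix; apply: IHk; move: Ix.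
apply: ideal_gen_min; first exact: ideal_exp_ideal.
move=> _ [u _ [v Iv <-]]; apply: ideal_mull => //; exact: ideal_exp_ideal.
Qed.

Lemma ideal_exp_exp_sub I a b : ideal_exp (ideal_exp I a) b `<=` ideal_exp I (a * b).
Proof.
apply: (@ideal_exp_min _ (fun b => ideal_exp I (a * b))).
- by move=> x; rewrite muln0.
- by move=> r; apply: ideal_exp_ideal.
- by move=> r x y Ix Iy; rewrite mulnS; apply: ideal_expM.
Qed.

Lemma ideal_mul_ideal_exp I J a b : ideal_set J ->
  (forall x y, ideal_exp I a x -> ideal_exp I b y -> J (x * y)) ->
  ideal_exp I (a + b) `<=` J.
Proof.
elim: a J => [|a IHa] J JI IJ.
  by move=> x Ix; rewrite -[x]mul1r; apply: IJ.
apply: ideal_gen_min => // _ [x Ix [y Iy <-]].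
suff: ideal_exp I (a + b) `<=` [set y | J (x * y)] by apply.
have [J0 JD JM] := JI; apply: IHa => [|u v Iu Iv] /=.
  split=> [|u v Ju Jv|c u Ju] /=; first by rewrite mulr0.
    by rewrite mulrDr; apply: JD.
  by rewrite mulrCA; apply: JM.
by rewrite mulrA; apply: IJ => //; apply: ideal_expS.
Qed.

Lemma ideal_exp_exp I a b : ideal_exp (ideal_exp I a) b = ideal_exp I (a * b).
Proof.
apply/seteqP; split; first exact: ideal_exp_exp_sub.
elim: b => [|b IHb]; first by rewrite muln0.
rewrite mulnS; apply: ideal_mul_ideal_exp => [|x y Ix Iy].
  exact: ideal_exp_ideal.
by apply: ideal_expS => //; apply: IHb.
Qed.


Lemma sub_integral_closure J : ideal_set J -> J `<=` integral_closure J.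
Proof.
move=> JI x Jx; exists 1%N, (fun=> - x); split=> // [i|].
  case: i => [|[|i]] // _; rewrite -[- x]mulr1.
  by apply: ideal_expS => //; apply: ideal_opp.
by rewrite big_nat1 subnn expr0 expr1 mulr1 subrr.
Qed.

Lemma big_dvdn_nat (t m : nat) (F : nat -> R) : (0 < t)%N ->
  \sum_(1 <= j < (t * m).+1 | (t %| j)%N) F j = \sum_(1 <= i < m.+1) F (t * i)%N.
Proof.
move=> t0; elim: m => [|m IHm]; first by rewrite muln0 !big_geq.
rewrite [RHS]big_nat_recr //= -IHm mulnS.
rewrite (big_cat_nat _ (n := (t * m).+1)) ?ltnS ?leq_addl //=; congr (_ + _).
rewrite big_mkcond big_nat_recr /=; last by rewrite -[X in (X < _)%N]add0n ltn_add2r.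
rewrite dvdn_addr ?dvdnn ?dvdn_mulr // big_nat_cond big1 ?add0r //.
move=> j /andP[/andP[lo hi] _]; case: ifP => // /dvdnP[i jE]; move: lo hi.
by rewrite {}jE -mulnS [(i * t)%N]mulnC !ltn_pmul2l // ltnS => lo; rewrite leqNgt lo.
Qed.

(** An integral equation of [f ^+ t] over [I ^ (r * t)], of degree [m], is
    already an integral equation of [f] over [I ^ r], of degree [t * m]: its
    only nonzero coefficients sit at the multiples [t * i] of [t], where
    [(I ^ (r * t)) ^ i] is [(I ^ r) ^ (t * i)]. *)
Lemma integral_closure_root I r t f : (0 < t)%N ->
  integral_closure (ideal_exp I (r * t)) (f ^+ t) ->
  integral_closure (ideal_exp I r) f.
Proof.
move=> t0 [m [c [m0 Ic fE]]].
exists (t * m)%N, (fun j => if (t %| j)%N then c (j %/ t)%N else 0); split.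
- by rewrite muln_gt0 t0.
- move=> j /andP[j0 jm]; case: ifP => [|_]; last first.
    by case: (ideal_exp_ideal (ideal_exp I r) j).
  case/dvdnP=> i jE; rewrite jE mulnK // [(i * t)%N]mulnC.
  rewrite ideal_exp_exp mulnA -ideal_exp_exp; apply: Ic; move: j0 jm.
  by rewrite jE [(i * t)%N]mulnC muln_gt0 leq_pmul2l // => /andP[_ ->].
rewrite -[RHS]fE exprM; congr (_ + _).
transitivity (\sum_(1 <= j < (t * m).+1 | (t %| j)%N)
    c (j %/ t)%N * f ^+ (t * m - j)).
  by rewrite [RHS]big_mkcond /=; apply: eq_bigr => j _; case: ifP; rewrite ?mul0r.
rewrite big_dvdn_nat //; apply: eq_bigr => i _.
by rewrite mulKn // -mulnBr exprM.
Qed.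

End Ideals.

(** * Specialization to positive characteristic *)

Section Specialization.
Variable K : fieldType.

(** The image of [e] is a subring of [K], presented by [R]. The condition says
    that the image maps to algebraically closed fields of positive
    characteristic, in sufficient supply to keep any one nonzero element
    nonzero. Working with [R] rather than with the image avoids subring types:
    a map out of the image is a map out of [R] that kills the kernel of [e]. *)
Definition specializable (R : comNzRingType) (e : {rmorphism R -> K}) : Prop :=
  forall d, e d != 0 ->
    exists (L : closedFieldType) (phi : {rmorphism R -> L}) (p : nat),
      [/\ p \in [pchar L], phi d != 0 & forall a, e a = 0 -> phi a = 0].

Lemma closed_field_pchar (p : nat) : prime p ->
  exists L : closedFieldType, p \in [pchar L].
Proof.
move=> pp; have [L [iota _]] := countable_algebraic_closure 'F_p.
exists L; have := pchar_Fp pp; rewrite !inE => /andP[-> /eqP p0].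
by rewrite -(rmorph_nat iota) p0 rmorph0 eqxx.
Qed.

(** In characteristic zero any prime not dividing [d] will do; a prime divisor
    of [d! + 1] is one. *)
Lemma specializable_int (e : {rmorphism int -> K}) : specializable e.
Proof.
move=> d ed; have eE z : e z = z%:~R by rewrite -[in LHS](intz z) rmorph_int.
have [p [pp pd e0]] : exists p, [/\ prime p, ~~ (p %| `|d|)%N &
    forall z, e z = 0 -> (p %| `|z|)%N].
  have [[p pK]|noK] := pselect (exists p, p \in [pchar K]).
    exists p; split; first by case/andP: pK.
      by apply: contra ed; rewrite eE -(dvdz_pcharf pK).
    by move=> z /eqP; rewrite eE -(dvdz_pcharf pK).
  exists (pdiv (`|d|%N`!.+1)); split; first by rewrite pdiv_prime // ltnS fact_gt0.
    apply/negP => pd; have d0 : (0 < `|d|)%N.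
      by rewrite absz_gt0; apply: contraNneq ed => ->; rewrite rmorph0.
    have pdp : prime (pdiv (`|d|%N`!.+1)) by rewrite pdiv_prime // ltnS fact_gt0.
    have := pdiv_dvd (`|d|%N`!.+1); rewrite -[X in (_ %| X)%N]addn1 dvdn_addr.
      by rewrite dvdn1 => /eqP p1; rewrite p1 in pdp.
    by apply: dvdn_trans pd _; apply: dvdn_fact; rewrite d0 leqnn.
  move=> z ez; suff -> : `|z|%N = 0%N by [].
  apply/eqP/negPn/negP => z0; have K0 : [pchar K] =i pred0.
    by move=> p; apply/negP => pK; apply: noK; exists p.
  move/pcharf0P: K0 => K0; case: z ez z0 => m; rewrite eE.
    by rewrite -[m%:~R]/(m%:R) => /eqP; rewrite K0 => ->.
  by rewrite NegzE mulrNz => /eqP; rewrite oppr_eq0 -[m.+1%:~R]/(m.+1%:R) K0.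
have [L pL] := closed_field_pchar pp.
exists L, (intmul 1 : {rmorphism int -> L}), p; split=> //=.
  by rewrite -(dvdz_pcharf pL).
by move=> a /e0 pa; apply/eqP; rewrite -(dvdz_pcharf pL).
Qed.

Section Adjoin.
Variables (R : comNzRingType) (e : {rmorphism R -> K}) (u : K).
Hypothesis e_spec : specializable e.
Local Notation "P ^e" := (map_poly e P) (at level 2, format "P ^e").

(** The image of [adjoin] is the image of [e] with [u] adjoined. *)
Definition adjoin : {rmorphism {poly R} -> K} :=
  @horner_morph _ _ e u (fun a => mulrC _ _).

Lemma adjoinE P : adjoin P = P^e.[u].
Proof. by []. Qed.

(** Dropping the terms whose coefficients vanish in [K] makes the leading
    coefficient invertible in [K], as pseudo-division requires. *)
Lemma map_poly_truncate (P : {poly R}) :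
  exists2 P', P'^e = P^e & size P' = size P^e.
Proof.
exists (\poly_(i < size P^e) P`_i).
  apply/polyP => i; rewrite !coef_map coef_poly; case: ltnP => // lei.
  by rewrite raddf0 -coef_map nth_default.
have [->|Pe0] := eqVneq P^e 0; first by rewrite size_poly0 poly_def big_ord0 size_poly0.
rewrite -(prednK (n := size P^e)) ?lt0n ?size_poly_eq0 // size_poly_eq //=.
by apply: contra_neq Pe0 => c0; apply/eqP; rewrite -lead_coef_eq0 lead_coefE coef_map c0 raddf0.
Qed.

(** A transcendental [u] may be sent anywhere, so it is enough to avoid the
    finitely many roots of [D] after specializing one nonzero coefficient to a
    nonzero value. *)
Lemma transcendental_specializable :
  (forall P, adjoin P = 0 -> P^e = 0) -> specializable adjoin.
Proof.
move=> tr D eD; have De0 : D^e != 0.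
  by apply: contra_neq eD => De0; rewrite adjoinE De0 horner0.
have [|L [phi [p [pL phiD ephi]]]] := e_spec (d := D`_(size D^e).-1).
  by rewrite -coef_map -lead_coefE lead_coef_eq0.
have : map_poly phi D != 0.
  by apply: contra_neq phiD => D0; rewrite -coef_map D0 coef0.
case/closed_nonrootP => v Dv.
exists L, (@horner_morph _ _ phi v (fun a => mulrC _ _)), p; split=> // P /tr P0.
rewrite /= /horner_morph [map_poly _ _](_ : _ = 0) ?horner0 //.
by apply/polyP => i; rewrite coef_map coef0; apply: ephi; rewrite -coef_map P0 coef0.
Qed.

Section Algebraic.
Variable Q : {poly R}.
Hypotheses (Q_size : size Q = size Q^e) (Qe0 : Q^e != 0) (Qu : adjoin Q = 0).
Hypothesis Q_min : forall P, adjoin P = 0 -> (size P^e < size Q)%N -> P^e = 0.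

Lemma pseudo_division (P D : {poly R}) : size D = size D^e -> D^e != 0 ->
  exists k U P', [/\ lead_coef D ^+ k *: P = U * D + P', (size P'^e < size D)%N
                   & e (lead_coef D) != 0].
Proof.
move=> sD De0; exists (Pdiv.Ring.rscalp P D), (Pdiv.Ring.rdivp P D), (Pdiv.Ring.rmodp P D).
split; first exact: Pdiv.ComRing.rdivp_eq.
  rewrite (leq_ltn_trans (size_poly _ _)) // Pdiv.Ring.ltn_rmodpN0 //.
  by rewrite -size_poly_eq0 sD size_poly_eq0.
by rewrite lead_coefE sD -coef_map -lead_coefE lead_coef_eq0.
Qed.

(** An element [P(u)] of an algebraic extension has a multiple in the base ring.
    Dividing the minimal polynomial [Q] by [P] repeatedly lowers the degree of
    [P], as in the Euclidean algorithm; a zero remainder would give a proper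
    factorization of [Q]. *)
Lemma minimal_inverse_small P : (size P^e < size Q)%N -> adjoin P != 0 ->
  exists U h, e h != 0 /\ adjoin (U * P) = e h.
Proof.
have [m] := ubnP (size P^e); elim: m => // m IHm in P *; rewrite ltnS => sPm sPQ.
wlog sP : P sPm sPQ / size P = size P^e.
  move=> W Pu; have [P' P'e sP'] := map_poly_truncate P.
  have P'u U : adjoin (U * P') = adjoin (U * P).
    by rewrite !rmorphM; congr (_ * _); rewrite !adjoinE P'e.
  have := W P'; rewrite P'e sPm sPQ sP' => /(_ isT isT erefl).
  have := P'u 1; rewrite !mul1r => ->.
  by case/(_ Pu) => U [h [eh Uh]]; exists U, h; rewrite -P'u.
move=> Pu; have Pe0 : P^e != 0.
  by apply: contra_neq Pu => Pe0; rewrite adjoinE Pe0 horner0.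
have [sP1|sP1] := leqP (size P) 1.
  exists 1, P`_0; rewrite mul1r adjoinE (size1_polyC sP1) map_polyC hornerC coefC eqxx.
  split=> //; apply: contra_neq Pu => c0.
  by rewrite adjoinE (size1_polyC sP1) map_polyC /= c0 horner0.
have [k [U [P' [PE P's lP]]]] := pseudo_division Q sP Pe0.
have P'u : adjoin P' = - adjoin (U * P).
  have := congr1 adjoin PE; rewrite rmorphD /= -mul_polyC rmorphM /= Qu mulr0.
  by move/esym/eqP; rewrite addrC addr_eq0 => /eqP.
have [P'0|P'0] := eqVneq (adjoin P') 0; last first.
  have [||V [h [eh Vh]]] := IHm P' _ _ P'0.
  - by rewrite (leq_trans P's) // sP.
  - by rewrite (ltn_trans P's) // sP.
  exists (- (V * U)), h; split=> //.
  by rewrite -Vh mulNr rmorphN -mulrA rmorphM /= -mulrN -P'u -rmorphM.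
exfalso; have Uu : adjoin U = 0.
  by apply/eqP; move/eqP: P'u; rewrite P'0 eq_sym oppr_eq0 rmorphM mulf_eq0 (negPf Pu) orbF.
have P'e0 : P'^e = 0.
  by apply: Q_min => //; rewrite (ltn_trans P's) // sP.
have := congr1 (map_poly e) PE; rewrite rmorphD rmorphM /= P'e0 addr0.
rewrite -mul_polyC rmorphM /= map_polyC /= rmorphXn /= => QE.
have Ue0 : U^e != 0.
  apply: contraNneq Qe0 => U0; move/eqP: QE.
  by rewrite U0 mul0r mulf_eq0 polyC_eq0 expf_eq0 (negPf lP) andbF.
move/eqP: (Ue0); apply; apply: Q_min => //.
have := congr1 (fun p : {poly K} => size p) QE.
rewrite mul_polyC size_scale ?expf_neq0 // -Q_size size_mul // -?sP => ->.
by rewrite -subn1 -addnBA ?(ltnW sP1) // -[X in (X < _)%N]addn0 ltn_add2l subn_gt0.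
Qed.

Lemma minimal_inverse P : adjoin P != 0 ->
  exists U h, e h != 0 /\ adjoin (U * P) = e h.
Proof.
move=> Pu; have [k [U [P' [PE P's lQ]]]] := pseudo_division P Q_size Qe0.
have P'u : adjoin P' = adjoin ((lead_coef Q ^+ k)%:P * P).
  by rewrite mul_polyC PE [RHS]rmorphD rmorphM /= Qu mulr0 add0r.
have [|V [h [eh Vh]]] := @minimal_inverse_small P' P's.
  rewrite P'u rmorphM mulf_neq0 //= /horner_morph map_polyC hornerC /=.
  by rewrite rmorphXn expf_neq0.
exists (V * (lead_coef Q ^+ k)%:P), h; split=> //.
by rewrite -Vh -mulrA rmorphM /= -P'u -rmorphM.
Qed.

(** An algebraic [u] must go to a root of the specialized minimal polynomial
    [Q]. Every relation satisfied by [u] is a multiple of [Q] up to a power of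
    the leading coefficient, so this is well defined as soon as the leading
    coefficient stays nonzero. A multiple [h] of [D(u)] lying in the base ring
    controls [D(u)]. *)
Lemma algebraic_specializable : specializable adjoin.
Proof.
move=> D Du; have [U [h [eh Uh]]] := minimal_inverse Du.
have lQ : e (lead_coef Q) != 0.
  by rewrite lead_coefE Q_size -coef_map -lead_coefE lead_coef_eq0.
have [|L [phi [p [pL phid ephi]]]] := e_spec (d := lead_coef Q * h).
  by rewrite rmorphM mulf_neq0.
move: phid; rewrite rmorphM mulf_eq0 negb_or => /andP[phiQ phih].
have : size (map_poly phi Q) != 1.
  rewrite size_map_poly_id0 // Q_size; apply: contraNneq Qe0 => /eqP/size_poly1P[c c0 Qc].
  by move/eqP: Qu; rewrite adjoinE Qc hornerC (negPf c0).
case/closed_rootP => v /rootP Qv.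
pose psi := @horner_morph _ _ phi v (fun a => mulrC _ _) : {rmorphism {poly R} -> L}.
have psiK P : adjoin P = 0 -> psi P = 0.
  move=> Pu; have [k [V [P' [PE P's _]]]] := pseudo_division P Q_size Qe0.
  have P'u : adjoin P' = 0.
    have := congr1 adjoin PE; rewrite rmorphD -mul_polyC !rmorphM /= Qu mulr0 add0r.
    by rewrite [X in _ * X]Pu mulr0.
  have P'e := Q_min P'u P's.
  have P'0 : psi P' = 0.
    rewrite /psi /= /horner_morph [map_poly _ _](_ : _ = 0) ?horner0 //.
    by apply/polyP => i; rewrite coef_map coef0; apply: ephi; rewrite -coef_map P'e coef0.
  have := congr1 psi PE; rewrite rmorphD P'0 addr0 rmorphM /= [X in _ * X]Qv mulr0.
  rewrite -mul_polyC rmorphM => /eqP; rewrite mulf_eq0 => /orP[|/eqP //].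
  by rewrite /= /horner_morph map_polyC hornerC /= rmorphXn expf_eq0 (negPf phiQ) andbF.
exists L, psi, p; split=> //.
have : psi (U * D - h%:P) = 0.
  by apply: psiK; rewrite rmorphB /= Uh /horner_morph map_polyC hornerC subrr.
move/eqP; rewrite rmorphB rmorphM subr_eq0 => /eqP UD.
apply: contra_neq phih => D0; move: UD; rewrite D0 mulr0 /psi /=.
by rewrite /horner_morph map_polyC hornerC => <-.
Qed.

End Algebraic.

Lemma adjoin_specializable : specializable adjoin.
Proof.
have [tr|/existsNP[P0 /not_implyP[P0u P0e]]] :=
  pselect (forall P, adjoin P = 0 -> P^e = 0).
  exact: transcendental_specializable.
pose A m := `[< exists P, [/\ adjoin P = 0, P^e <> 0 & size P^e = m] >].
have exA : exists m, A m by exists (size P0^e); apply/asboolP; exists P0.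
have [m /asboolP[P [Pu Pe sP]] minA] := ex_minnP exA.
have [Q QP sQ] := map_poly_truncate P.
apply: (@algebraic_specializable Q) => [|||P' P'u P's].
- by rewrite QP.
- by rewrite QP; apply/eqP.
- by rewrite adjoinE QP.
apply: contrapT => P'e; have /minA : A (size P'^e) by apply/asboolP; exists P'.
by rewrite leqNgt -sP -sQ P's.
Qed.

End Adjoin.

(** Iterated univariate polynomial rings over the integers present every
    finitely generated subring of [K]. *)
Lemma specializable_cover (s : seq K) :
  exists (R : comNzRingType) (e : {rmorphism R -> K}),
    specializable e /\ forall x, x \in s -> exists a, e a = x.
Proof.
elim: s => [|u s [R [e [spec_e cover]]]].
  by exists int, (intmul 1 : {rmorphism int -> K}); split=> //; apply: specializable_int.
exists {poly R}, (adjoin e u); split; first exact: adjoin_specializable.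
move=> x; rewrite inE => /predU1P[->|/cover[a <-]].
  by exists 'X; rewrite adjoinE map_polyX hornerX.
by exists a%:P; rewrite adjoinE map_polyC hornerC.
Qed.

End Specialization.

(** * Hilbert's basis theorem *)

Section FiniteGeneration.

(** Dickson's lemma, for the exponent vectors [w a]. The elements dominated by
    no member of a basis for the first [n] coordinates have bounded last
    coordinate, hence fall into finitely many slices. *)
Lemma dickson n (T : Type) (A : set T) (w : T -> nat -> nat) :
  exists (J : finType) (b : J -> T), (forall j, A (b j)) /\
    forall a, A a -> exists j, forall i, (i < n)%N -> (w (b j) i <= w a i)%N.
Proof.
elim: n => [|n IHn] in A *.
  have [[a Aa]|noA] := pselect (exists a, A a).
    by exists unit, (fun=> a); split=> // a' _; exists tt.
  by exists void, (fun i : void => match i with end); split=> [[]|a Aa]; case: noA; exists a.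
have [J [b [Ab domb]]] := IHn A.
pose k0 := (\max_j w (b j) n)%N.
have slice (k : 'I_k0) : exists Jb : {J : finType & J -> T},
    (forall j, A (projT2 Jb j) /\ w (projT2 Jb j) n = k) /\
    forall a, A a /\ w a n = k -> exists j, forall i, (i < n)%N -> (w (projT2 Jb j) i <= w a i)%N.
  by have [J' [b' Ab']] := IHn (fun a => A a /\ w a n = k); exists (existT _ J' b').
have [Jb Jbp] := choice slice.
pose J2 := (J + {k : 'I_k0 & projT1 (Jb k)})%type : finType.
exists J2, (fun j : J2 => match j with inl j => b j
  | inr u => projT2 (Jb (projT1 u)) (projT2 u) end); split=> [[j|[k j]] //=|a Aa].
  by case: (Jbp k) => /(_ j) [].
have [lo|hi] := leqP k0 (w a n).
  have [j jle] := domb a Aa; exists (inl j) => i; rewrite ltnS leq_eqVlt => /predU1P[->|/jle//].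
  by apply: leq_trans lo; apply: (@leq_bigmax _ (fun j => w (b j) n)).
have [Jk /(_ a (conj Aa erefl)) [j jle]] := Jbp (Ordinal hi).
exists (inr (existT _ (Ordinal hi) j)) => i /=; rewrite ltnS leq_eqVlt.
case/predU1P=> [->|/jle//]; by case: (Jk j) => _ ->.
Qed.

Variables (K : fieldType) (n : nat).
Implicit Types (p q : {mpoly K[n]}) (I G : set {mpoly K[n]}).

Lemma ltm_mleadB p q : mlead q = mlead p -> mleadc q = mleadc p -> p - q != 0 ->
  (mlead (p - q) < mlead p)%O.
Proof.
move=> lqp cqp pq0; have := mleadB_le p q; rewrite lqp joinxx le_eqVlt.
case/predU1P=> // lpq; have := mlead_supp pq0.
by rewrite mcoeff_msupp lpq mcoeffB -{2}lqp cqp subrr eqxx.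
Qed.

(** A Groebner basis: the leading monomials of [I] have finitely many divisors
    in [I] by Dickson's lemma, and division by these lowers leading monomials. *)
Lemma ideal_finite_basis I : ideal_set I ->
  exists (J : finType) (b : J -> {mpoly K[n]}), I = ideal_gen (range b).
Proof.
move=> II; have [I0 ID IM] := II.
have [J [b [Ib domb]]] := dickson n (fun p => I p /\ p != 0) (fun p i => nth 0%N (mlead p) i).
exists J, b; apply/seteqP; split; last first.
  by apply: ideal_gen_min => // _ [j _ <-]; case: (Ib j).
have [g0 gD gM] := ideal_gen_ideal (range b).
elim/mleadrect => p IHp Ip; have [->//|p0] := eqVneq p 0.
have [j lej] := domb p (conj Ip p0); have [Ibj bj0] := Ib j.
have lejm : (mlead (b j) <= mlead p)%MM.
  by apply/mnm_lepP => i; rewrite !(mnm_nth 0%N); apply: lej.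
pose t := (mleadc p / mleadc (b j)) *: 'X_[(mlead p - mlead (b j))%MM].
have lc0 : mleadc p / mleadc (b j) != 0 by rewrite mulf_neq0 ?invr_eq0 ?mleadc_eq0.
have t0 : t != 0 by rewrite scaler_eq0 negb_or lc0 -msize_poly_eq0 mmeasureX.
have lt : mlead t = (mlead p - mlead (b j))%MM by rewrite mleadZ // mleadXm.
have gt : ideal_gen (range b) (t * b j) by apply: gM; apply: sub_ideal_gen; exists j.
have [pE|pt0] := eqVneq (p - t * b j) 0; first by rewrite -[p](subrK (t * b j)) pE add0r.
have ltb : mlead (t * b j) = mlead p by rewrite mleadM // lt submK.
rewrite -[p](subrK (t * b j)); apply: gD => //; apply: IHp; last first.
  by apply: ID => //; rewrite -mulNr; apply: IM.
apply: ltm_mleadB => //; rewrite ltb -[in LHS](submK lejm) -lt mleadcM.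
by rewrite {1}lt mcoeffZ mcoeffX eqxx mulr1 divfK // mleadc_eq0.
Qed.

(** The finite basis is chosen inside the given set of generators, so that
    homogeneous generators stay homogeneous. *)
Lemma hilbert_basis G : exists (T : finType) (g : T -> {mpoly K[n]}),
  (forall t, G (g t)) /\ ideal_gen G = ideal_gen (range g).
Proof.
have [J [b Gb]] := ideal_finite_basis (ideal_gen_ideal G).
have fin j : exists kg : {k : nat & 'I_k -> {mpoly K[n]}},
    (forall i, G (projT2 kg i)) /\ ideal_gen (range (projT2 kg)) (b j).
  have [k [c [g [_ Gg ->]]]] : ideal_gen G (b j) by rewrite Gb; apply: sub_ideal_gen; exists j.
  exists (existT _ k g); split=> //; apply: ideal_sum; first exact: ideal_gen_ideal.
  by move=> i _; apply: lincomb1 => //; exists i.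
have [kg kgP] := choice fin.
pose T := {j : J & 'I_(projT1 (kg j))} : finType.
pose g (t : T) := projT2 (kg (projT1 t)) (projT2 t).
have Gg t : G (g t) by case: t => j i; case: (kgP j) => /(_ i).
exists T, g; split=> //; apply/seteqP; split; last first.
  by apply: ideal_gen_min => [|_ [t _ <-]]; [exact: ideal_gen_ideal|exact: sub_ideal_gen].
rewrite Gb; apply: ideal_gen_min => [|_ [j _ <-]]; first exact: ideal_gen_ideal.
have [_] := kgP j; apply: ideal_gen_min; first exact: ideal_gen_ideal.
by move=> _ [i _ <-]; apply: sub_ideal_gen; exists (existT _ j i).
Qed.

End FiniteGeneration.

(** * Frobenius powers and the Cartier operator *)

Section CoefficientFunctions.
Variables (R : nzRingType) (n : nat).

Definition mpoly_of_coef (k : nat) (E : 'X_{1..n} -> R) : {mpoly R[n]} :=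
  \sum_(m : 'X_{1..n < k}) E m *: 'X_[m].

Lemma mcoeff_mpoly_of_coef k E m : (forall m, (k <= mdeg m)%N -> E m = 0) ->
  (mpoly_of_coef k E)@_m = E m.
Proof.
move=> E0; have [lo|hi] := leqP k (mdeg m); last by rewrite mcoeff_mpoly.
rewrite E0 // raddf_sum big1 //= => m' _; rewrite mcoeffZ mcoeffX.
case: eqP => [mm'|_]; last by rewrite mulr0.
by have := bmdeg m'; rewrite mm' ltnNge lo.
Qed.

Lemma mcoeffMX_le (p : {mpoly R[n]}) a m :
  (p * 'X_[a])@_m = if (a <= m)%MM then p@_(m - a) else 0.
Proof.
case: ifP => am; first by rewrite -{1}(submK am) addmC mcoeffMX.
apply/memN_msupp_eq0; rewrite (perm_mem (msuppMX _ _)).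
apply: contraFN am => /mapP[m' _ ->]; exact: lem_addr.
Qed.

End CoefficientFunctions.

(** For [q] a power of the characteristic, this is the ideal J^[[q]]. *)
Definition frobenius_power (R : comNzRingType) (J : set R) (q : nat) : set R :=
  ideal_gen [set g ^+ q | g in J].

Section Frobenius.
Variables (L : closedFieldType) (p : nat).
Hypothesis pL : p \in [pchar L].

Let pp : prime p. Proof. by case/andP: pL. Qed.

Lemma frobeniusD (R : comNzRingType) e (x y : R) : p \in [pchar R] ->
  (x + y) ^+ (p ^ e) = x ^+ (p ^ e) + y ^+ (p ^ e).
Proof.
move=> pR; rewrite exprDn_pchar // pnatX; apply/orP; left.
by rewrite pnatE.
Qed.

Lemma frobenius_root e : exists rt : L -> L, forall a, rt a ^+ (p ^ e) = a.
Proof.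
suff /choice[rt rtP] : forall a : L, exists b, b ^+ (p ^ e) = a by exists rt.
move=> a; have q0 : (0 < p ^ e)%N by rewrite expn_gt0 prime_gt0.
have : size ('X^(p ^ e) - a%:P) != 1%N by rewrite size_XnsubC // eqSS -lt0n.
case/closed_rootP => b; rewrite /root hornerD hornerN hornerXn hornerC subr_eq0.
by move/eqP; exists b.
Qed.

Lemma frobenius_inj e : injective (fun x : L => x ^+ (p ^ e)).
Proof.
move=> x y /= xy; apply/eqP; rewrite -subr_eq0.
have : (x - y) ^+ (p ^ e) = 0.
  apply: (addIr (y ^+ (p ^ e))); rewrite -frobeniusD //.
  by rewrite subrK add0r.
by move/eqP; rewrite expf_eq0 => /andP[].
Qed.

Variable n : nat.
Implicit Types g h z : {mpoly L[n]}.

Lemma pchar_mpoly : p \in [pchar {mpoly L[n]}].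
Proof.
rewrite inE pp /= -(rmorph_nat (@mpolyC n L)).
by rewrite (pcharf0 pL) raddf0.
Qed.

(** Over a perfect field of characteristic [p], with [q] a power of [p], the
    monomials [x^b] with all exponents below [q] are a basis of the polynomial
    ring over its subring of [q]-th powers. The operator [tau] extracts the
    [q]-th root of the coefficient of one of them; its linearity over [q]-th
    powers is the flatness of Frobenius in the form used below. *)
Lemma cartier_operator e (b : 'X_{1..n}) : (forall i, (b i < p ^ e)%N) ->
  exists tau : {mpoly L[n]} -> {mpoly L[n]},
  [/\ forall h m, (tau h)@_m ^+ (p ^ e) = h@_(m *+ (p ^ e) + b)%MM,
      forall h h', tau (h + h') = tau h + tau h'
    & forall g h, tau (h * g ^+ (p ^ e)) = tau h * g].
Proof.
set q := (p ^ e)%N => bq; have q0 : (0 < q)%N by rewrite expn_gt0 prime_gt0.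
have [rt rtK] := frobenius_root e; rewrite -/q in rtK.
have rt0 : rt 0 = 0 by apply: (@frobenius_inj e); rewrite -/q rtK expr0n gtn_eqF.
pose tau h := mpoly_of_coef (msize h) (fun m => rt h@_(m *+ q + b)%MM).
have tauE h m : (tau h)@_m = rt h@_(m *+ q + b)%MM.
  apply: (mcoeff_mpoly_of_coef (E := fun m => rt h@_(m *+ q + b)%MM)) => {}m le_hm.
  rewrite memN_msupp_eq0 //; apply: msize_mdeg_ge; rewrite mdegD mdegMn.
  by rewrite (leq_trans le_hm) // (leq_trans (leq_pmulr _ q0)) // leq_addr.
have tauX h m : (tau h)@_m ^+ q = h@_(m *+ q + b)%MM by rewrite tauE rtK.
have tauD h h' : tau (h + h') = tau h + tau h'.
  apply/mpolyP => m; rewrite mcoeffD; apply: (@frobenius_inj e).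
  by rewrite frobeniusD // -/q !tauX mcoeffD.
exists tau; split=> // g h.
elim/mpolyind: g => [|c a g _ _ IHg].
  rewrite expr0n gtn_eqF // !mulr0; apply/mpolyP => m.
  by rewrite tauE !mcoeff0.
rewrite frobeniusD ?pchar_mpoly // !mulrDr tauD IHg; congr (_ + _).
apply/mpolyP => m; apply: (@frobenius_inj e); rewrite -/q tauX.
rewrite exprZn mpolyXn -!scalerAr !mcoeffZ !mcoeffMX_le exprMn; congr (_ * _).
have -> : (a *+ q <= m *+ q + b)%MM = (a <= m)%MM.
  apply/mnm_lepP/mnm_lepP => le_am i; last first.
    by rewrite mnmDE !mulmnE (leq_trans _ (leq_addr _ _)) // leq_mul2r le_am orbT.
  have := le_am i; rewrite mnmDE !mulmnE leqNgt => lt_am; rewrite leqNgt.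
  apply: contra lt_am => lt_ma; rewrite (leq_trans (n := (m i).+1 * q)) //.
    by rewrite mulSn addnC ltn_add2r.
  by rewrite leq_mul2r lt_ma orbT.
case: ifP => [le_am|_]; last by rewrite expr0n gtn_eqF.
rewrite tauX; congr mcoeff; apply/mnmP => i; rewrite mnmBE !mnmDE !mulmnE mnmBE.
by rewrite mulnBl addnBAC // leq_mul2r; move/mnm_lepP: le_am => ->; rewrite orbT.
Qed.

(** The mechanism of tight closure in a regular ring. Extracting from
    [c * z ^ q] the coefficient along the leading monomial of [c], for [q] larger
    than the degree of [c], turns [c] into a nonzero constant, [z ^ q] into [z]
    and the Frobenius power of [J] into [J]. *)
Lemma frobenius_multiplier (J : set {mpoly L[n]}) c z : ideal_set J -> c != 0 ->
  (forall e, frobenius_power J (p ^ e) (c * z ^+ (p ^ e))) -> J z.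
Proof.
move=> JI c0 cz; have [J0 JD JM] := JI.
(* [p ^ e] exceeds [e], hence exceeds the degree of [c]. *)
pose b := mlead c; pose e := msize c.
have ltq : (msize c < p ^ e)%N by apply: ltn_expl; apply: prime_gt1.
have bq i : (b i < p ^ e)%N.
  apply: leq_ltn_trans ltq; rewrite ltnW // -mlead_deg // ltnS mdegE.
  by rewrite (bigD1 i) //= leq_addr.
have [tau [tauX tauD tauM]] := cartier_operator bq.
have tau0 : tau 0 = 0 by apply: (addIr (tau 0)); rewrite -tauD !add0r.
have tauc m : m != 0%MM -> (tau c)@_m = 0.
  move=> m0; apply: (@frobenius_inj e); rewrite tauX expr0n.
  rewrite gtn_eqF ?expn_gt0 ?prime_gt0 // memN_msupp_eq0 //.
  apply: msize_mdeg_ge; rewrite (leq_trans (ltnW ltq)) // mdegD mdegMn.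
  by rewrite (leq_trans _ (leq_addr _ _)) // leq_pmull // lt0n mdeg_eq0.
have tauc0 : (tau c)@_0%MM != 0.
  have bE : (0 *+ (p ^ e) + b)%MM = b by apply/mnmP => i; rewrite mnmDE mulmnE mnm0E.
  have := tauX c 0%MM; rewrite bE; apply: contra_eq_neq => ->.
  by rewrite expr0n gtn_eqF ?expn_gt0 ?prime_gt0 // eq_sym mleadc_eq0.
have taucE : tau c = ((tau c)@_0%MM)%:MP.
  apply/mpolyP => m; rewrite mcoeffC; case: eqP => [->|/eqP/tauc->].
    by rewrite mulr1.
  by rewrite mulr0.
have : J (tau (c * z ^+ (p ^ e))).
  elim/lincomb_ind: (cz e) => [|x y Jx Jy|h _ _ [g Jg <-]].
  - by rewrite tau0.
  - by rewrite tauD; apply: JD.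
  - by rewrite tauM; apply: JM.
rewrite tauM taucE mul_mpolyC => Jz.
rewrite -[z]scale1r -(mulVf tauc0) -scalerA -mul_mpolyC; exact: JM.
Qed.

End Frobenius.

(** * The Briancon-Skoda inclusion in positive characteristic *)

Section FinitelyGeneratedPowers.
Variables (R : comNzRingType) (T : finType) (f : T -> R).
Local Notation I := (ideal_gen (range f)).

Lemma ideal_exp_range r : ideal_exp I r `<=`
  ideal_gen (range (fun s : r.-tuple T => \prod_(i <- s) f i)).
Proof.
apply: (@ideal_exp_min _ _ (fun r =>
  ideal_gen (range (fun s : r.-tuple T => \prod_(i <- s) f i)))).
- move=> x; rewrite -[x]mulr1; apply: ideal_mull; first exact: ideal_gen_ideal.
  by apply: sub_ideal_gen; exists [tuple] => //; rewrite big_nil.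
- by move=> {}r; apply: ideal_gen_ideal.
move=> {}r x y; apply: lincombM => // _ _ [i _ <-] [s _ <-].
by exists [tuple of i :: s] => //; rewrite big_cons.
Qed.

Lemma ideal_exp_prod (s : seq T) : ideal_exp I (size s) (\prod_(i <- s) f i).
Proof.
elim: s => [|i s IHs]; first by [].
by rewrite big_cons; apply: ideal_expS => //; apply: sub_ideal_gen; exists i.
Qed.

Lemma ideal_exp_monomial (P : seq T) (a : T -> nat) :
  ideal_exp I (\sum_(i <- P) a i) (\prod_(i <- P) f i ^+ a i).
Proof.
elim: P => [|i P IHP]; first by rewrite !big_nil.
rewrite !big_cons; apply: ideal_expM => //.
by apply: ideal_exp_pow; apply: sub_ideal_gen; exists i.
Qed.

(** Pigeonhole: in a monomial of degree [(r + #|T|) * q] in the generators,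
    pulling out the largest [q]-th power of each generator leaves exponents
    below [q], of total at most [#|T| * q]; so the root of the part pulled out
    has degree at least [r]. *)
Lemma ideal_exp_frobenius r q : (0 < q)%N ->
  ideal_exp I ((r + #|T|) * q) `<=` frobenius_power (ideal_exp I r) q.
Proof.
move=> q0 x /ideal_exp_range; apply: ideal_gen_min; first exact: ideal_gen_ideal.
move=> _ [s _ <-].
have -> : \prod_(i <- s) f i =
    (\prod_i f i ^+ (count_mem i s %% q)) * (\prod_i f i ^+ (count_mem i s %/ q)) ^+ q.
  rewrite -prodrXl -big_split /=.
  under [RHS]eq_bigr => i _ do rewrite -exprM -exprD addnC -divn_eq.
  elim: (val s) => [|i {}s IHs] /=; first by rewrite big_nil big1.
  rewrite big_cons IHs [in RHS](bigD1 i) //= eqxx exprD expr1 -mulrA.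
  rewrite [in LHS](bigD1 i) //=; congr (_ * (_ * _)); apply: eq_bigr => j ji.
  by rewrite eq_sym (negPf ji).
apply: ideal_mull; first exact: ideal_gen_ideal.
apply: sub_ideal_gen; eexists; last by reflexivity.
apply: ideal_exp_le (ideal_exp_monomial (index_enum T) _).
rewrite -(leq_pmul2r q0) -(leq_add2r (#|T| * q)) -mulnDl -{1}(size_tuple s).
have <- : (\sum_i count_mem i s = size s)%N.
  elim: (val s) => [|i {}s IHs] /=; first by rewrite big1.
  rewrite big_split /= IHs -add1n; congr (_ + _)%N.
  by rewrite (bigD1 i) //= eqxx big1 ?addn0 // => j; rewrite eq_sym => /negPf ->.
rewrite -sum_nat_const big_distrl -big_split /=; apply: leq_sum => i _.
by rewrite {1}(divn_eq (count_mem i s) q) leq_add2l ltnW // ltn_pmod.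
Qed.

End FinitelyGeneratedPowers.

Section IntegralMultiplier.
Variables (R : comNzRingType) (I : set R) (m d : nat) (c : nat -> R) (z : R).
Hypothesis Ic : forall i, (1 <= i <= d)%N -> ideal_exp I (m * i) (c i).
Hypothesis zE : z ^+ d + \sum_(1 <= i < d.+1) c i * z ^+ (d - i) = 0.

(** An element of a fixed power of [I ^ m] multiplies [z ^+ N] into
    [(I ^ m) ^ N] for every [N]: the equation of [z] lowers [N] below [d], each
    step gaining in [c i] as many factors of [I ^ m] as it loses powers of [z].
    The parameter [a] keeps the account of the gains in the induction. *)
Lemma integral_multiplier N a x :
  ideal_exp I (m * (d + a)) x -> ideal_exp I (m * (N + a)) (x * z ^+ N).
Proof.
have [k] := ubnP N; elim: k => // k IHk in N a x *; rewrite ltnS => leNk Ix.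
have [Nd|dN] := ltnP N d.
  apply: ideal_mulr; first exact: ideal_exp_ideal.
  by apply: ideal_exp_le Ix; rewrite leq_mul2l leq_add2r ltnW ?orbT.
move/eqP: zE; rewrite addr_eq0 => /eqP zd.
rewrite -[in z ^+ N](subnKC dN) exprD zd mulNr mulrN big_distrl big_distrr /=.
apply: ideal_opp; first exact: ideal_exp_ideal.
rewrite big_seq; apply: ideal_sum; first exact: ideal_exp_ideal.
move=> i; rewrite mem_index_iota ltnS => /andP[i1 id].
rewrite -mulrA -exprD mulrA.
have -> : (d - i + (N - d) = N - i)%N by lia.
have -> : (N + a = N - i + (a + i))%N by lia.
apply: IHk; first by lia.
by rewrite addnA mulnDr; apply: ideal_expM => //; apply: Ic; rewrite i1.
Qed.

End IntegralMultiplier.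

Lemma briancon_skoda_pchar (L : closedFieldType) p (pL : p \in [pchar L]) n
    (T : finType) (f : T -> {mpoly L[n]}) (I := ideal_gen (range f)) r d c z :
  (exists t, f t != 0) ->
  (forall i, (1 <= i <= d)%N -> ideal_exp I ((r + #|T|) * i) (c i)) ->
  z ^+ d + \sum_(1 <= i < d.+1) c i * z ^+ (d - i) = 0 ->
  ideal_exp I r z.
Proof.
move=> [t ft0] Ic zE.
apply: (frobenius_multiplier pL (c := f t ^+ ((r + #|T|) * d))).
- exact: ideal_exp_ideal.
- exact: expf_neq0.
move=> e; apply: ideal_exp_frobenius.
  by rewrite expn_gt0 prime_gt0 //; case/andP: pL.
rewrite -[X in (_ * X)%N]addn0; apply: (integral_multiplier Ic zE).
by rewrite addn0; apply: ideal_exp_pow; apply: sub_ideal_gen; exists t.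
Qed.

(** * Certificates of non-membership, and their transport *)

Section Lifting.
Variables (R S : comNzRingType) (n : nat) (e : {rmorphism R -> S}).

(** The normalization [g 0 = 0] makes coefficientwise lifting of a polynomial
    finitely supported. *)
Lemma scalar_section : exists g : S -> R, g 0 = 0 /\
  forall x, (exists a, e a = x) -> e (g x) = x.
Proof.
have /choice[g gP] : forall x, exists a, (x = 0 -> a = 0) /\ ((exists a, e a = x) -> e a = x).
  move=> x; have [->|x0] := eqVneq x 0; first by exists 0; split=> // _; apply: rmorph0.
  have [[a ea]|no] := pselect (exists a, e a = x).
    by exists a; split=> // /eqP; rewrite (negPf x0).
  by exists 0; split.
by exists g; split=> [|x]; [apply: (gP 0).1 | apply: (gP x).2].
Qed.

Lemma map_mpoly_lift (g : S -> R) (P : {mpoly S[n]}) : g 0 = 0 ->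
  (forall m, e (g P@_m) = P@_m) ->
  map_mpoly e (mpoly_of_coef (msize P) (fun m => g P@_m)) = P.
Proof.
move=> g0 eg; apply/mpolyP => m; rewrite mcoeff_map_mpoly.
rewrite (mcoeff_mpoly_of_coef (E := fun m => g P@_m)) => [|{}m le_Pm]; first exact: eg.
by rewrite memN_msupp_eq0 // msize_mdeg_ge.
Qed.

End Lifting.

Section CoefficientPairing.
Variables (n k : nat).

Definition coef_pairing (R : comNzRingType) (w : 'X_{1..n < k} -> R) (P : {mpoly R[n]}) : R :=
  \sum_(m : 'X_{1..n < k}) P@_m * w m.

Lemma coef_pairing0 (R : comNzRingType) w : coef_pairing (R := R) w 0 = 0.
Proof. by apply: big1 => m _; rewrite mcoeff0 mul0r. Qed.

Lemma coef_pairingD (R : comNzRingType) w (P Q : {mpoly R[n]}) :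
  coef_pairing w (P + Q) = coef_pairing w P + coef_pairing w Q.
Proof. by rewrite -big_split; apply: eq_bigr => m _; rewrite mcoeffD mulrDl. Qed.

Lemma coef_pairingZ (R : comNzRingType) w a (P : {mpoly R[n]}) :
  coef_pairing w (a *: P) = a * coef_pairing w P.
Proof. by rewrite [RHS]big_distrr; apply: eq_bigr => m _ /=; rewrite mcoeffZ mulrA. Qed.

Lemma coef_pairing_map (R S : comNzRingType) (e : {rmorphism R -> S}) w P :
  coef_pairing (e \o w) (map_mpoly e P) = e (coef_pairing w P).
Proof. by rewrite rmorph_sum; apply: eq_bigr => m _ /=; rewrite mcoeff_map_mpoly rmorphM. Qed.

(** A pairing that sees only degrees below [k] vanishes on all multiples of [P]
    once it vanishes on the multiples by monomials of degree below [k]. *)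
Lemma coef_pairing_ideal_gen (R : comNzRingType) (A : set {mpoly R[n]}) w :
  (forall (m : 'X_{1..n < k}) P, A P -> coef_pairing w ('X_[m] * P) = 0) ->
  forall P, ideal_gen A P -> coef_pairing w P = 0.
Proof.
move=> wA P; elim/lincomb_ind=> {P} [|P Q IHP IHQ|h P _ AP].
- exact: coef_pairing0.
- by rewrite coef_pairingD IHP IHQ addr0.
elim/mpolyind: h => [|c m h _ _ IHh]; first by rewrite mul0r coef_pairing0.
rewrite mulrDl coef_pairingD IHh addr0 -scalerAl coef_pairingZ.
have [lo|hi] := leqP k (mdeg m); last by rewrite (wA (BMultinom hi)) ?mulr0.
rewrite [coef_pairing _ _]big1 ?mulr0 // => m' _.
rewrite [_ * P]mulrC mcoeffMX_le; case: ifP => [mm'|_]; last by rewrite mul0r.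
by have := leq_trans lo (lemc_mdeg (lem_leo mm')); rewrite leqNgt bmdeg.
Qed.

(** Because the [v j] are homogeneous, truncation below degree [k] keeps or kills
    each of them as a whole; hence [z] lies in their span as soon as its
    truncation lies in the span of theirs. This is a finite linear system, and
    an unsolvable one has a dual certificate [w]. *)
Lemma separating_coefficients (K : fieldType) (J : finType) (v : J -> {mpoly K[n]})
    (dg : J -> nat) (z : {mpoly K[n]}) :
  (forall j, v j \is (dg j).-homog) -> (msize z <= k)%N ->
  (forall a : J -> K, z <> \sum_j a j *: v j) ->
  exists w : 'X_{1..n < k} -> K, coef_pairing w z = 1 /\ forall j, coef_pairing w (v j) = 0.
Proof.
move=> hv zk nz.
pose N := #|{: 'X_{1..n < k}}|.
pose mon (b : 'I_N) : 'X_{1..n < k} := enum_val b.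
pose row_of (P : {mpoly K[n]}) : 'rV[K]_N := \row_b P@_(mon b).
pose M : 'M[K]_(#|J|, N) := \matrix_(a < #|J|) row_of (v (enum_val a)).
have [/submxP[D zD]|] := boolP (row_of z <= M)%MS.
  exfalso; pose a j := if (dg j < k)%N then D 0 (enum_rank j) else 0.
  apply: (nz a); apply/mpolyP => m; rewrite raddf_sum /=.
  have [lo|hi] := leqP k (mdeg m).
    rewrite memN_msupp_eq0 ?msize_mdeg_ge ?(leq_trans zk) // big1 // => j _.
    rewrite mcoeffZ /a; case: ifP => [jk|_]; last by rewrite mul0r.
    by rewrite (dhomog_nemf_coeff (hv j)) ?mulr0 // gtn_eqF // (leq_trans jk).
  have := congr1 (fun A : 'rV_N => A 0 (enum_rank (BMultinom hi))) zD.
  rewrite mxE /mon enum_rankK /= => ->; rewrite mxE (reindex (@enum_rank J)) /=; last first.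
    by apply: onW_bij; apply: enum_rank_bij.
  apply: eq_bigr => j _; rewrite !mxE /mon !enum_rankK mcoeffZ /a.
  case: ifP => // /negbT jk; rewrite mul0r (dhomog_nemf_coeff (hv j)) ?mulr0 //=.
  by apply: contra jk => /eqP <-.
rewrite submxE => /matrix0Pn[i [c zc]].
pose w0 : 'X_{1..n < k} -> K := fun m => cokermx M (enum_rank m) c.
have w0E P : coef_pairing w0 P = (row_of P *m cokermx M) 0 c.
  rewrite mxE [RHS](reindex (@enum_rank _)) /=; last first.
    by apply: onW_bij; apply: enum_rank_bij.
  by apply: eq_bigr => m _; rewrite mxE /mon enum_rankK.
have scale P u : coef_pairing (fun m => w0 m / u) P = coef_pairing w0 P / u.
  by rewrite [RHS]big_distrl; apply: eq_bigr => m _; rewrite mulrA.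
exists (fun m => w0 m / coef_pairing w0 z); split=> [|j]; rewrite scale.
  by rewrite divff // w0E -(ord1 i).
suff -> : coef_pairing w0 (v j) = 0 by rewrite mul0r.
rewrite w0E; have <- : row (enum_rank j) M = row_of (v j).
  by rewrite rowK enum_rankK.
by rewrite -row_mul mulmx_coker !mxE.
Qed.

End CoefficientPairing.

(** * The Briancon-Skoda inclusion over an arbitrary field *)

Section BrianconSkoda.
Variables (K : fieldType) (n : nat) (T : finType) (f : T -> {mpoly K[n]}).
Hypotheses (f_homog : forall t, f t \is ishomog mdeg) (f_neq0 : exists t, f t != 0).
Local Notation I := (ideal_gen (range f)).

Lemma not_in_power_certificate r z k : (msize z <= k)%N -> ~ ideal_exp I r z ->
  exists w : 'X_{1..n < k} -> K, coef_pairing w z = 1 /\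
    forall (m : 'X_{1..n < k}) (s : r.-tuple T),
      coef_pairing w ('X_[m] * \prod_(i <- s) f i) = 0.
Proof.
move=> zk nz; have /choice[dg hf] : forall t, exists d, f t \is d.-homog.
  by move=> t; apply/homogP.
pose v (j : 'X_{1..n < k} * r.-tuple T) := 'X_[j.1] * \prod_(i <- j.2) f i.
have [j|//|a za|w [wz wv]] := @separating_coefficients _ k _ _ v
  (fun j => mdeg j.1 + \sum_(i <- j.2) dg i)%N z.
- apply: dhomogM; first by rewrite dhomogX.
  elim: (val j.2) => [|i s IHs]; first by rewrite !big_nil dhomog1.
  by rewrite !big_cons; apply: dhomogM.
- apply: nz; rewrite za; apply: ideal_sum; first exact: ideal_exp_ideal.
  move=> [m s] _; rewrite /v /= scalerAl; apply: ideal_mull; first exact: ideal_exp_ideal.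
  by have := ideal_exp_prod f s; rewrite size_tuple.
by exists w; split=> // m s; apply: (wv (m, s)).
Qed.

(** If [z] were outside [I ^ r], then a certificate [w] of this, the integral
    equation of [z] and the generators of [I] would be finitely many scalars
    bound by polynomial identities. Specializing them to positive
    characteristic preserves the identities, hence yields an integral element
    outside the power that contains it there. The nonzero coefficient kept
    nonzero is a leading coefficient of a generator: the ideal must not become
    zero. *)
Lemma briancon_skoda r :
  integral_closure (ideal_exp I (r + #|T|)) `<=` ideal_exp I r.
Proof.
move=> z [d [c [_ Ic zE]]]; apply: contrapT => nIz; pose m := (r + #|T|)%N.
have [w [wz wI]] := not_in_power_certificate (leqnn (msize z)) nIz.
have /choice[h hE] : forall i, exists h : seq T -> {mpoly K[n]}, (1 <= i <= d)%N ->
    c i = \sum_(s : (m * i).-tuple T) h s * \prod_(t <- s) f t.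
  move=> i; have [id|_] := boolP (1 <= i <= d)%N; last by exists (fun=> 0).
  have := Ic i id; rewrite ideal_exp_exp => /ideal_exp_range/ideal_gen_range[h0 hE].
  exists (fun s => if insub s is Some t then h0 t else 0) => _; rewrite hE.
  by apply: eq_bigr => s _; rewrite valK.
(* The scalars to specialize are the certificate and the coefficients of [z],
   of the generators and of the integral equation written in terms of them. *)
pose polys := z :: [seq f t | t : T] ++
  [seq h i (val s) | i <- iota 1 d, s <- enum {: (m * i).-tuple T}].
have [R [e [spec_e cover]]] := specializable_cover
  ([seq w j | j : 'X_{1..n < msize z}] ++ [seq P@_j | P <- polys, j <- msupp P]).
have [g [g0 eg]] := scalar_section e.
pose lift (P : {mpoly K[n]}) := mpoly_of_coef (msize P) (fun m => g P@_m).
have liftE P : P \in polys -> map_mpoly e (lift P) = P.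
  move=> Pp; apply: map_mpoly_lift => // j; have [->|Pj] := eqVneq P@_j 0.
    by rewrite g0 rmorph0.
  apply/eg/cover; rewrite mem_cat; apply/orP; right.
  by apply: allpairs_f_dep => //; rewrite mcoeff_msupp.
clearbody lift.
have lift_z : map_mpoly e (lift z) = z by apply: liftE; rewrite mem_head.
have lift_f t : map_mpoly e (lift (f t)) = f t.
  by apply: liftE; rewrite inE mem_cat map_f ?orbT // mem_enum.
have lift_h i (s : (m * i).-tuple T) : (1 <= i <= d)%N ->
    map_mpoly e (lift (h i s)) = h i s.
  move=> id; apply: liftE; rewrite inE mem_cat; apply/orP; right; apply/orP; right.
  apply: (allpairs_f_dep (fun i (s : (m * i).-tuple T) => h i s)); last by rewrite mem_enum.
  by rewrite mem_iota add1n ltnS.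
have eg_w j : e (g (w j)) = w j.
  by apply/eg/cover; rewrite mem_cat map_f // mem_enum.
pose cR i := \sum_(s : (m * i).-tuple T) lift (h i s) * \prod_(t <- s) lift (f t).
have cRE i : (1 <= i <= d)%N -> map_mpoly e (cR i) = c i.
  move=> id; rewrite (hE _ id) rmorph_sum; apply: eq_bigr => s _.
  by rewrite rmorphM /= lift_h // rmorph_prod; congr (_ * _); apply: eq_bigr => t _; apply: lift_f.
pose ER := lift z ^+ d + \sum_(1 <= i < d.+1) cR i * lift z ^+ (d - i).
have ER0 : map_mpoly e ER = 0.
  rewrite rmorphD rmorphXn rmorph_sum /= lift_z -[RHS]zE; congr (_ + _).
  rewrite !big_seq; apply: eq_bigr => i; rewrite mem_index_iota ltnS => id.
  by rewrite rmorphM rmorphXn /= lift_z cRE.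
have [t0 ft0] := f_neq0.
have [|L [phi [p [pL phi_t0 ephi]]]] := spec_e ((lift (f t0))@_(mlead (f t0))).
  by rewrite -mcoeff_map_mpoly lift_f mleadc_eq0.
have phi0 (P : {mpoly R[n]}) : map_mpoly e P = 0 -> map_mpoly phi P = 0.
  move=> P0; apply/mpolyP => j; rewrite mcoeff_map_mpoly mcoeff0; apply: ephi.
  by rewrite -mcoeff_map_mpoly P0 mcoeff0.
pose fL t := map_mpoly phi (lift (f t)).
have zL : ideal_exp (ideal_gen (range fL)) r (map_mpoly phi (lift z)).
  apply: (@briancon_skoda_pchar L p pL n T fL r d (fun i => map_mpoly phi (cR i))).
  - exists t0; apply: contra_neq phi_t0 => ft0L.
    by rewrite -mcoeff_map_mpoly -/(fL t0) ft0L mcoeff0.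
  - move=> i _; rewrite rmorph_sum; apply: ideal_sum => [|s _]; first exact: ideal_exp_ideal.
    rewrite rmorphM; apply: ideal_mull; first exact: ideal_exp_ideal.
    by rewrite rmorph_prod -[X in ideal_exp _ X](size_tuple s); apply: ideal_exp_prod.
  - rewrite -[RHS](phi0 _ ER0) rmorphD rmorphXn rmorph_sum; congr (_ + _).
    by apply: eq_bigr => i _; rewrite rmorphM rmorphXn.
pose wR j := g (w j).
have ewR P : e (coef_pairing wR P) = coef_pairing w (map_mpoly e P).
  by rewrite -coef_pairing_map; apply: eq_bigr => j _; rewrite /= /wR eg_w.
(* The specialized certificate contradicts [zL]. *)
have : coef_pairing (phi \o wR) (map_mpoly phi (lift z)) = 0.
  apply: coef_pairing_ideal_gen (ideal_exp_range zL) => j _ [s _ <-].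
  have -> : 'X_[j] * \prod_(i <- s) fL i = map_mpoly phi ('X_[j] * \prod_(i <- s) lift (f i)).
    by rewrite rmorphM rmorph_prod /= map_mpolyX.
  rewrite coef_pairing_map; apply: ephi; rewrite ewR rmorphM rmorph_prod /= map_mpolyX.
  by rewrite -[RHS](wI j s); congr coef_pairing; congr (_ * _); apply: eq_bigr.
rewrite coef_pairing_map => /eqP; apply/negP.
suff -> : phi (coef_pairing wR (lift z)) = 1 by apply: oner_neq0.
apply/eqP; rewrite -subr_eq0 -(rmorph1 phi) -rmorphB; apply/eqP/ephi.
by rewrite rmorphB rmorph1 ewR lift_z wz subrr.
Qed.

End BrianconSkoda.

(** * Symbolic powers and the comparison of resurgences *)

Section SymbolicPowers.
Variable R : idomainType.
Implicit Types I P : set R.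

Lemma localizationM P (x y : {fraction R}) : prime_idealr_closed (mem P) ->
  localization P x -> localization P y -> localization P (x * y).
Proof.
move=> primeP [a _ [b Pb <-]] [a' _ [b' Pb' <-]].
exists (a * a') => //; exists (b * b'); last by rewrite !tofracM invfM mulrACA.
move=> Pbb'; have /orP[/set_mem//|/set_mem//] := primeP b b' (mem_set Pbb').
Qed.

Lemma symbolic_powerX I s t f :
  symbolic_power I s f -> symbolic_power I (s * t) (f ^+ t).
Proof.
move=> sIf P PI; have [[_ P1 _] primeP _] := PI; have {sIf} := sIf P PI.
rewrite /preimage /= => sIf; elim: t => [|t IHt].
  rewrite muln0 expr0 -[tofrac 1]mulr1; apply: lincomb1; last by exists 1; rewrite ?rmorph1.
  by exists 1 => //; exists 1; [move=> /mem_set; apply/negP | rewrite rmorph1 divr1].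
rewrite mulnS exprS tofracM.
apply: lincombM sIf IHt => [b b'|_ _ [u Iu <-] [v Iv <-]]; first exact: localizationM.
by exists (u * v); [exact: ideal_expM | rewrite tofracM].
Qed.

End SymbolicPowers.

Section ResurgenceComparison.
Variable F : realType.

Lemma sup_ratio_le (Q Q' : nat -> nat -> Prop) :
  (forall s r, (0 < s)%N -> (0 < r)%N -> Q s r -> Q' s r) ->
  (sup_ratio F Q <= sup_ratio F Q')%E.
Proof.
move=> QQ'; apply: le_ereal_sup => _ [s [r [s0 r0 Qsr ->]]].
by exists s, r; split=> //; apply: QQ'.
Qed.

Variables (R : idomainType) (I : set R).

(** A witness [f] for the pair [(s, r)] has powers [f ^+ t] that are witnesses
    for all the pairs [(s * t, r * t)]. *)
Lemma ic_resurgence_le_asymptotic :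
  (ic_resurgence F I <= ic_asymptotic_resurgence F I)%E.
Proof.
apply: sup_ratio_le => s r _ _ sI; near=> t; apply: contra_not sI => stI f sIf.
have t0 : (0 < t)%N by near: t; exists 1%N.
by apply: (integral_closure_root t0); apply/stI/symbolic_powerX.
Unshelve. all: by end_near. Qed.

Lemma ic_asymptotic_resurgence_le :
  (ic_asymptotic_resurgence F I <= asymptotic_resurgence F I)%E.
Proof.
apply: sup_ratio_le => s r _ _; apply: filterS => t; apply: contra_not => stI f /stI.
by apply: sub_integral_closure; apply: ideal_exp_ideal.
Qed.

(** A ratio [s / r] above [v] stays above [v] after adding a constant to the
    denominator, once numerator and denominator are scaled up enough. *)
Lemma scaled_ratio_gt (v : F) (s r l t0 : nat) : (0 < r)%N ->
  v < s%:R / r%:R ->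
  exists t, [/\ (t0 <= t)%N, (0 < t)%N & v < (s * t)%:R / (r * t + l)%:R].
Proof.
move=> r0 vsr; have r0F : 0 < r%:R :> F by rewrite ltr0n.
have gap : 0 < s%:R - v * r%:R by rewrite subr_gt0 -ltr_pdivlMr.
pose t := maxn t0 (Num.bound `|v * l%:R / (s%:R - v * r%:R)|).+1.
have t1 : (0 < t)%N by rewrite leq_max orbT.
exists t; split=> //; first exact: leq_maxl.
rewrite ltr_pdivlMr; last by rewrite ltr0n addn_gt0 muln_gt0 r0 t1.
rewrite natrD !natrM mulrDr mulrA -ltrBrDl -mulrBl -ltr_pdivrMl // [X in X < _]mulrC.
apply: le_lt_trans (ler_norm _) _; apply: lt_trans (archi_boundP (normr_ge0 _)) _.
by rewrite ltr_nat leq_max ltnSn orbT.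
Qed.

(** A constant shift [l] between integral closures and ordinary powers is
    invisible asymptotically: if [s / r] exceeded the supremum, so would the
    ratio of some [s * t] and [r * t + l], and the symbolic power of order
    [s * t] would be contained in the power of order [r * t]. *)
Lemma asymptotic_resurgence_le_ic (l : nat) :
  (forall r, integral_closure (ideal_exp I (r + l)) `<=` ideal_exp I r) ->
  (asymptotic_resurgence F I <= ic_resurgence F I)%E.
Proof.
move=> bs; apply: ge_ereal_sup => _ [s [r [s0 r0 [t0 _ nsub] ->]]].
rewrite leNgt; apply/negP => lt_sr.
have [v vsr ub] : exists2 v : F, v < s%:R / r%:R & forall s' r', (0 < s')%N -> (0 < r')%N ->
    ~ (symbolic_power I s' `<=` integral_closure (ideal_exp I r')) -> s'%:R / r'%:R <= v.
  have ub s' r' : (0 < s')%N -> (0 < r')%N ->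
      ~ (symbolic_power I s' `<=` integral_closure (ideal_exp I r')) ->
      ((s'%:R / r'%:R)%:E <= ic_resurgence F I)%E.
    by move=> s'0 r'0 nsub'; apply: ereal_sup_ubound; exists s', r'.
  case: (ic_resurgence F I) lt_sr ub => [v|//|_] ub; first by exists v.
  exists (s%:R / r%:R - 1); first by rewrite ltrBlDr ltrDl.
  by move=> s' r' s'0 r'0 /(ub _ _ s'0 r'0).
have [t [t0t t1 vt]] := scaled_ratio_gt l t0 r0 vsr.
apply: (nsub t t0t) => f sIf; apply: bs.
have /contrapT : ~ ~ (symbolic_power I (s * t) `<=`
    integral_closure (ideal_exp I (r * t + l))); last exact.
move/ub; rewrite addn_gt0 !muln_gt0 s0 r0 t1 => /(_ isT isT).
by rewrite leNgt vt.
Qed.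

Lemma normal_ic_resurgence : normal_ideal I -> ic_resurgence F I = resurgence F I.
Proof.
by move=> nI; apply/le_anti/andP; split; apply: sup_ratio_le => s r s0 r0;
  rewrite nI.
Qed.

End ResurgenceComparison.

Theorem corollary4p13 (F : realType) (K : fieldType) (n : nat)
    (I : set {mpoly K[n]})
    (I_proper_ideal : idealr_closed (mem I))
    (I_nonzero : I <> [set 0])
    (I_homogeneous : homogeneous_ideal I) :
  [/\ asymptotic_resurgence F I = ic_asymptotic_resurgence F I,
      ic_asymptotic_resurgence F I = ic_resurgence F I
    & normal_ideal I -> asymptotic_resurgence F I = resurgence F I].
Proof.
have [G G_homog IG] := I_homogeneous.
have [T [f [Gf GE]]] := hilbert_basis G.
have [f_neq0|f0] := pselect (exists t, f t != 0); last first.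
  case: I_nonzero; rewrite IG GE; apply/seteqP; split=> [x /ideal_gen_range[h ->]|_ ->].
    rewrite /= big1 // => t _; have [->|ft] := eqVneq (f t) 0; first by rewrite mulr0.
    by case: f0; exists t.
  by case: (ideal_gen_ideal (range f)).
have bs r : integral_closure (ideal_exp I (r + #|T|)) `<=` ideal_exp I r.
  by rewrite IG GE; apply: briancon_skoda => // t; apply: G_homog.
have le_a_ic := asymptotic_resurgence_le_ic F bs.
have le_ic_ica := ic_resurgence_le_asymptotic F I.
have le_ica_a := ic_asymptotic_resurgence_le F I.
have a_ica : asymptotic_resurgence F I = ic_asymptotic_resurgence F I.
  by apply/le_anti; rewrite le_ica_a (le_trans le_a_ic).
have ica_ic : ic_asymptotic_resurgence F I = ic_resurgence F I.
  by apply/le_anti; rewrite le_ic_ica (le_trans le_ica_a).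
by split=> // nI; rewrite a_ica ica_ic normal_ic_resurgence.
Qed.
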